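(* Let $R$ be a simple right Goldie ring with the $2$-nil-sum property. Then $R$ is a field.
   Context: All rings are associative with identity. A central unit of $R$ is a unit of $R$ lying in the center of $R$; a non central-unit is an element that is not a central unit. A ring $R$ has the $2$-nil-sum property if every non central-unit of $R$ is a sum of two nilpotent elements of $R$. *)

(* Defs.v *)
From mathcomp Require Import all_boot all_algebra.
Set Implicit Arguments. Unset Strict Implicit. Unset Printing Implicit Defensive.
Import GRing.Theory.
Local Open Scope ring_scope.

Definition nilpotent_el (R : ringType) (x : R) : Prop := exists n : nat, x ^+ n = 0.

Definition central (R : ringType) (x : R) : Prop := forall y : R, x * y = y * x.

Definition central_unit (R : unitRingType) (x : R) : Prop :=
  x \is a GRing.unit /\ central x.

Definition two_nil_sum (R : unitRingType) : Prop :=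
  forall x : R, ~ central_unit x ->
    exists a b : R, nilpotent_el a /\ nilpotent_el b /\ x = a + b.

Definition right_ideal (R : ringType) (I : R -> Prop) : Prop :=
  [/\ I 0, (forall x y, I x -> I y -> I (x - y)) & (forall x r, I x -> I (x * r))].

Definition two_sided_ideal (R : ringType) (I : R -> Prop) : Prop :=
  [/\ I 0, (forall x y, I x -> I y -> I (x - y)),
      (forall x r, I x -> I (x * r)) & (forall x r, I x -> I (r * x))].

(* simple ring: nonzero (built into ringType) and only trivial two-sided ideals *)
Definition simple_ring (R : ringType) : Prop :=
  forall I : R -> Prop, two_sided_ideal I ->
    (forall x, I x -> x = 0) \/ (forall x, I x).

Definition rann (R : ringType) (S : R -> Prop) : R -> Prop :=
  fun r => forall s, S s -> s * r = 0.

Definition is_right_annihilator (R : ringType) (A : R -> Prop) : Prop :=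
  exists S : R -> Prop, forall r, A r <-> rann S r.

Definition acc_right_annihilators (R : ringType) : Prop :=
  forall A : nat -> (R -> Prop),
    (forall n, is_right_annihilator (A n)) ->
    (forall n r, A n r -> A n.+1 r) ->
    exists N, forall n, (N <= n)%N -> forall r, A n r -> A N r.

Definition in_finite_sum (R : ringType) (I : nat -> R -> Prop) (n : nat) (r : R) : Prop :=
  exists a : nat -> R, (forall k, (k < n)%N -> I k (a k)) /\ r = \sum_(k < n) a k.

(* finite right uniform (Goldie) dimension: R_R contains no infinite direct
   sum of nonzero right ideals *)
Definition finite_right_uniform_dim (R : ringType) : Prop :=
  ~ exists I : nat -> R -> Prop,
      (forall n, right_ideal (I n)) /\
      (forall n, exists x, I n x /\ x <> 0) /\
      (forall n x, I n x -> in_finite_sum I n x -> x = 0).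

Definition right_goldie (R : ringType) : Prop :=
  finite_right_uniform_dim R /\ acc_right_annihilators R.

(* field: commutative, and every nonzero element is invertible (1 <> 0 holds
   in any ringType) *)
Definition is_field (R : unitRingType) : Prop :=
  (forall x y : R, x * y = y * x) /\ (forall x : R, x != 0 -> x \is a GRing.unit).

(* Main.v *)
(** A nonzero u whose right annihilator is maximal satisfies
    u s u t = 0 -> u s u = 0 \/ u t = 0, and this passes to every x in uR, so
    the products x s x behave as in a domain.  Semiprimeness provides such an x
    with x^2 <> 0.  If x = a + b with a, b nilpotent, put c = - b, so a = c + x
    and the resolvent identity reads
    a^(n+1) = c^(n+1) + \sum_(i + j = n) c^i x a^j.
    Multiply by x on both sides and take n = k + m, where k and m are the last
    exponents with x c^k x <> 0 and x a^m x <> 0: only the term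
    x c^k x a^m x survives, so it is 0, a contradiction.  Hence x is a central
    unit, R is a domain, and 0 is its only sum of two nilpotents. *)
Require Import Defs.
From Stdlib Require Import Classical ClassicalEpsilon.
From mathcomp Require Import all_boot all_algebra.
Set Implicit Arguments. Unset Strict Implicit. Unset Printing Implicit Defensive.
Import GRing.Theory.
Local Open Scope ring_scope.

Definition domain_like (R : nzRingType) (x : R) : Prop :=
  forall s t, x * s * x * t = 0 -> x * s * x = 0 \/ x * t = 0.

(** The right annihilator of [u R] is a two-sided ideal containing [u]; if it is all of [R], then
    [u * 1 * 1 = 0]. *)
Lemma simple_semiprime (R : nzRingType) (u : R) :
  simple_ring R -> (forall r, u * r * u = 0) -> u = 0.
Proof.
move=> simR uRu0.
have [|I0|IT] := simR (fun z => forall r, u * r * z = 0); last 2 first.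
- exact: I0.
- by have := IT 1 1; rewrite !mulr1.
split=> [r|x y xI yI r|x s xI r|x s xI r].
- by rewrite mulr0.
- by rewrite mulrBr xI yI subrr.
- by rewrite mulrA xI mul0r.
- by rewrite !mulrA -(mulrA u r s).
Qed.

(** Otherwise choice builds, starting from [1], a strictly ascending chain of annihilators of
    nonzero elements. *)
Lemma exists_maximal_rann (R : nzRingType) :
  acc_right_annihilators R ->
  exists2 u : R, u <> 0 & forall v : R, v <> 0 ->
    (forall r, u * r = 0 -> v * r = 0) -> forall r, v * r = 0 -> u * r = 0.
Proof.
move=> acc; apply: NNPP => nomax.
have step (u : {u : R | u <> 0}) : exists v : {v : R | v <> 0},
    (forall r, sval u * r = 0 -> sval v * r = 0) /\
    exists2 r, sval v * r = 0 & sval u * r <> 0.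
  apply: NNPP => nov; apply: nomax; exists (sval u); first exact: svalP u.
  move=> v v0 uv r vr; apply: NNPP => ur.
  by apply: nov; exists (exist _ v v0); split=> //; exists r.
pose next u := sval (constructive_indefinite_description _ (step u)).
pose f n := iter n next (exist _ 1 (elimN eqP (oner_neq0 R))).
have fP n := svalP (constructive_indefinite_description _ (step (f n))).
have [||N stable] := acc (fun n r => sval (f n) * r = 0).
- move=> n; exists (fun s => s = sval (f n)) => r.
  by split=> [fr s -> //|]; apply.
- by move=> n; have [] := fP n.
have [_ [r vr ur]] := fP N.
by apply: ur; apply: stable (leqnSn N) _ vr.
Qed.

Lemma exists_domain_like (R : nzRingType) :
  simple_ring R -> acc_right_annihilators R ->
  exists2 x : R, x * x <> 0 & domain_like x.
Proof.
move=> simR /exists_maximal_rann [u u0 umax].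
have domu (s t : R) : u * s * u * t = 0 -> u * s * u = 0 \/ u * t = 0.
  move=> e; have [->|usu] := classic (u * s * u = 0); first by left.
  (* Maximality is applied to [v = u * s * u], which kills whatever [u] kills. *)
  by right; apply: umax e => // r ur; rewrite -mulrA ur mulr0.
have [[r urur]|sq0] := classic (exists r, u * r * (u * r) <> 0).
  exists (u * r) => // s t; rewrite !mulrA -!(mulrA u r) -(mulrA _ r t).
  by case/domu => [->|->]; [left; rewrite mul0r|right].
have {}sq0 r : u * r * (u * r) = 0 by apply: NNPP => ?; apply: sq0; exists r.
have uu : u * u = 0 by have := sq0 1; rewrite mulr1.
case: u0; apply: simple_semiprime => // r.
(* Linearise the square-zero identity at u + u r. *)
have := sq0 (1 + r).
by rewrite mulrDr mulr1 mulrDl !mulrDr sq0 uu addr0 add0r mulrA uu mul0r add0r.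
Qed.

Lemma resolvent_exp (R : nzRingType) (x c : R) n :
  (c + x) ^+ n.+1 = c ^+ n.+1 + \sum_(i < n.+1) c ^+ i * x * (c + x) ^+ (n - i).
Proof.
elim: n => [|n IHn]; first by rewrite big_ord1 !expr1 expr0 mul1r mulr1.
rewrite exprS mulrDl {1}IHn mulrDr -exprS -addrA [in RHS]big_ord_recl subn0 mul1r.
congr (_ + _); rewrite addrC; congr (_ + _).
by rewrite big_distrr; apply: eq_bigr => i _; rewrite lift0 exprS /= !mulrA.
Qed.

(** Exponent 0 qualifies because [x * x <> 0], and nilpotency bounds the exponents. *)
Lemma last_nonzero_sandwich (R : nzRingType) (x c : R) :
  x * x <> 0 -> nilpotent_el c ->
  exists2 k, x * c ^+ k * x <> 0 &
    forall i, (k < i)%N -> x * c ^+ i * x = 0.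
Proof.
move=> xx [n cn0].
have exP : exists k, x * c ^+ k * x != 0.
  by exists 0%N; rewrite expr0 mulr1; apply/eqP.
have ubP k : x * c ^+ k * x != 0 -> (k <= n)%N.
  rewrite leqNgt; apply: contra => nk.
  by rewrite -(subnK (ltnW nk)) exprD cn0 !mulr0 mul0r.
case: (ex_maxnP exP ubP) => k /eqP kn0 kmax; exists k => // i ki.
by apply/eqP; apply: contraLR ki => /kmax; rewrite -leqNgt.
Qed.

Lemma domain_like_not_sum_nilpotents (R : nzRingType) (x a b : R) :
  x * x <> 0 -> domain_like x ->
  nilpotent_el a -> nilpotent_el b -> x <> a + b.
Proof.
move=> xx domx nila nilb xab.
have nilc : nilpotent_el (- b).
  by case: nilb => n bn0; exists n; rewrite exprNn bn0 mulr0.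
have [m xam amax] := last_nonzero_sandwich xx nila.
have [k xck cmax] := last_nonzero_sandwich xx nilc.
have def_a : a = - b + x by rewrite xab addrCA addNr addr0.
have := congr1 (fun z => x * z * x) (resolvent_exp x (- b) (k + m)).
rewrite -def_a mulrDr mulrDl amax ?ltnS ?leq_addl // cmax ?ltnS ?leq_addr //.
have ltk : (k < (k + m).+1)%N by rewrite ltnS leq_addr.
rewrite add0r big_distrr big_distrl (bigD1 (Ordinal ltk)) //= big1 => [|i nik].
  rewrite addr0 addKn !mulrA -[_ * x]mulrA => /esym /domx [//|].
  by rewrite mulrA.
(* For [i < k] the power of [a] exceeds [m]; for [i > k] the factor [x * c ^+ i * x] vanishes. *)
have [ik|ki|eik] := ltngtP i k; last by case/eqP: nik; apply: val_inj.
  have mi : (m < k + m - i)%N by rewrite ltn_subRL ltn_add2r.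
  by rewrite -!mulrA (mulrA x (a ^+ _)) amax // !mulr0.
by rewrite !mulrA cmax // !mul0r.
Qed.

Lemma domain_nilpotent_eq0 (R : nzRingType) (a : R) :
  (forall y z : R, y * z = 0 -> y = 0 \/ z = 0) -> nilpotent_el a -> a = 0.
Proof.
move=> dom [n]; elim: n => [|n IHn]; first by move/eqP; rewrite expr0 oner_eq0.
by rewrite exprS => /dom [|/IHn].
Qed.

Lemma unit_domain_like_domain (R : unitRingType) (x : R) :
  x \is a GRing.unit -> domain_like x ->
  forall y z : R, y * z = 0 -> y = 0 \/ z = 0.
Proof.
move=> Ux domx y z yz0.
(* As [x] is invertible, every [y] has the form [x * s * x]. *)
have xx : x * (x^-1 * y * x^-1) * x = y by rewrite !mulrA mulrV // mul1r mulrVK.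
have [|yx0|xz0] := domx (x^-1 * y * x^-1) z; first by rewrite xx.
- by left; rewrite -xx.
- by right; apply: (mulrI Ux); rewrite xz0 mulr0.
Qed.

Theorem theorem3p8 (R : unitRingType) :
  simple_ring R -> right_goldie R -> two_nil_sum R -> is_field R.
Proof.
move=> simR [_ acc] nilsum.
have [x xx domx] := exists_domain_like simR acc.
have [Ux _] : central_unit x.
  apply: NNPP => /nilsum [a [b [nila [nilb]]]].
  exact: domain_like_not_sum_nilpotents.
have dom := unit_domain_like_domain Ux domx.
have cu (y : R) : y <> 0 -> central_unit y.
  move=> y0; apply: NNPP => /nilsum [a [b [nila [nilb yab]]]]; apply: y0.
  by rewrite yab (domain_nilpotent_eq0 dom nila) (domain_nilpotent_eq0 dom nilb) addr0.
split=> [y z|y /eqP /cu []] //.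
have [->|/cu [_]] := classic (y = 0); last exact.
by rewrite mul0r mulr0.
Qed.
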